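(* Fix $c$ and consider a stationary queueing system at congestion level $c$ (the Markov chain defined in the context). Let $M=(M_{ji}:(j,i)\in\mathcal K)$ record the stationary number of packets of each route at each queue. Then $M$ has distribution $$\mathbb P(M=m)=\frac1{B_{G^{(c)}}}\prod_{j\in\mathcal J}\left(\frac{m_j!}{\prod_{i:\,j\in i}m_{ji}!}\,\frac1{C_j^{m_j}}\right)\times\prod_{i\in\mathcal I}e^{G_i^{(c)}(\bar m_i)},\qquad m\in\mathbb Z_+^K,$$ where $m_j=\sum_{i:j\in i}m_{ji}$, $\bar m_i=\sum_{j\in i}m_{ji}$ and $$B_{G^{(c)}}=\sum_{m\in\mathbb Z_+^K}\ \prod_{j\in\mathcal J}\left(\frac{m_j!}{\prod_{i:\,j\in i}m_{ji}!}\,\frac1{C_j^{m_j}}\right)\times\prod_{i\in\mathcal I}e^{G_i^{(c)}(\bar m_i)}.$$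
   Context: **Network.** $\mathcal J$ is a finite set of queues. $\mathcal I$ is a finite set of routes, each route $i\in\mathcal I$ being a non-empty subset of $\mathcal J$ together with an ordering $(j_1^i,\dots,j_{k_i}^i)$ of its elements. $\mathcal K=\{(j,i)\in\mathcal J\times\mathcal I: j\in i\}$, $K=|\mathcal K|$. Each queue $j$ has capacity $C_j\in(0,\infty)$. For each queue $j$ and $n\ge1$, $(\gamma_j(l,n))_{l=1}^n$ and $(\delta_j(l,n))_{l=1}^n$ are probability vectors (service proportions and insertion probabilities of positions). **Queueing system at congestion level $c$.** A state is $s=(s^j:j\in\mathcal J)$, where $s^j=(i^j_1,\dots,i^j_{m_j})$ is a finite word of routes $i\ni j$ (the routes of the packets in positions $1,\dots,m_j$ of queue $j$). Let $m_{ji}$ be the number of occurrences of $i$ in $s^j$, so $m_j=\sum_{i:j\in i}m_{ji}$, and let $\bar m_i=\sum_{j\in i}m_{ji}$ (the state of congestion window $i$). The system is the continuous-time Markov chain with the following transitions (rates of different events leading to the same state are added): - injection: for each route $i$, with $j=j_1^i$ and $l=1,\dots,m_j+1$, a route $i$ packet is inserted in position $l$ of queue $j$ (packets in positions $l,\dots,m_j$ move to $l+1,\dots,m_j+1$) at rate $g_i^{(c)}(\bar m_i)\,\delta_j(l,m_j+1)$; - transfer: if $i^j_l=i$, $j=j^i_k$, $j'=j^i_{k+1}$, $1\le k\le k_i-1$, the packet in position $l$ of queue $j$ leaves (packets in positions $l+1,\dots,m_j$ move to $l,\dots,m_j-1$) and is inserted in position $l'\in\{1,\dots,m_{j'}+1\}$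 of queue $j'$ at rate $C_j\gamma_j(l,m_j)\,\delta_{j'}(l',m_{j'}+1)$; - acknowledgement: if $i^j_l=i$ and $j=j^i_{k_i}$, the packet in position $l$ of queue $j$ leaves the system at rate $C_j\gamma_j(l,m_j)$. Here $g_i^{(c)}(k)=e^{G_i^{(c)}(k+1)-G_i^{(c)}(k)}$ for $k\in\mathbb Z_+$, where $G_i^{(c)}:\mathbb R_+\to[-\infty,\infty)$ is strictly concave and finite on $\mathbb Z_+$. A stationary queueing system is this chain distributed according to a stationary probability distribution; $M_{ji}$ is the count $m_{ji}$ under it. *)

(* Defs.v *)
From HB Require Import structures.
From mathcomp Require Import all_boot all_order all_algebra.
From mathcomp Require Import all_classical all_reals all_analysis.

Set Implicit Arguments.
Unset Strict Implicit.
Unset Printing Implicit Defensive.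

Import Order.TTheory GRing.Theory Num.Theory.
Import numFieldNormedType.Exports.

Local Open Scope classical_set_scope.
Local Open Scope ring_scope.

Section MarkovChain.
Context {R : realType} {S : choiceType}.

(* Only the off-diagonal entries of the rate function q are used.  [exit_rate]
   is real-valued; in this file each state has finitely many successors, so the
   sum is finite. *)
Definition exit_rate (q : S -> S -> R) (s : S) : R :=
  fine (\esum_(u in [set u | u != s]) (q s u)%:E).

Definition q_matrix (q : S -> S -> R) (s s' : S) : R :=
  if s == s' then - exit_rate q s else q s s'.

Record is_transition_function (q : S -> S -> R) (P : R -> S -> S -> R) : Prop :=
  { tf_ge0 : forall (t : R) s s', 0 <= t -> 0 <= P t s s' ;
    tf_sum1 : forall (t : R) s, 0 <= t -> \esum_(s' in [set: S]) (P t s s')%:E = 1%E ;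
    tf_0 : forall s s', P 0 s s' = (s == s')%:R ;
    tf_chapman_kolmogorov : forall (t u : R) s s', 0 <= t -> 0 <= u ->
      (P (t + u) s s')%:E = \esum_(r in [set: S]) (P t s r * P u r s')%:E ;
    tf_rates : forall s s',
      (P t s s' - (s == s')%:R) / t @[t --> 0^'+] --> q_matrix q s s' }.

Definition is_distribution (p : S -> R) : Prop :=
  (forall s, 0 <= p s) /\ \esum_(s in [set: S]) (p s)%:E = 1%E.

Definition is_stationary (P : R -> S -> S -> R) (p : S -> R) : Prop :=
  is_distribution p /\
  forall (t : R) s', 0 <= t -> \esum_(s in [set: S]) (p s * P t s s')%:E = (p s')%:E.

Definition law (T : eqType) (p : S -> R) (f : S -> T) (x : T) : \bar R :=
  \esum_(s in [set s | f s == x]) (p s)%:E.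

End MarkovChain.

(* The strict inequality is only required on the effective domain G > -oo. *)
Definition strictly_concave_on_Rplus {R : realType} (G : R -> \bar R) : Prop :=
  (forall x : R, 0 <= x -> (G x < +oo)%E) /\
  (forall x y t : R, 0 <= x -> 0 <= y -> x != y -> 0 < t -> t < 1 ->
     (-oo < G x)%E -> (-oo < G y)%E ->
     (t%:E * G x + (1 - t)%:E * G y < G (t * x + (1 - t) * y)%R)%E).

(* Route i is the ordered set of queues [first_queue i :: next_queues i], so
   k_i = (size (next_queues i)).+1.  Hops and positions are numbered from 0:
   gamma_j(l, n), with l in 1..n, is [gamma j l.-1 n], similarly for delta. *)
Record network (R : realType) (J I : finType) := Network {
  first_queue : I -> J ;
  next_queues : I -> seq J ;
  route_uniq : forall i, uniq (first_queue i :: next_queues i) ;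
  capacity : J -> R ;
  capacity_gt0 : forall j, 0 < capacity j ;
  gamma : J -> nat -> nat -> R ;
  gamma_ge0 : forall j l n, (l < n)%N -> 0 <= gamma j l n ;
  gamma_sum1 : forall j n, (0 < n)%N -> \sum_(l < n) gamma j l n = 1 ;
  delta : J -> nat -> nat -> R ;
  delta_ge0 : forall j l n, (l < n)%N -> 0 <= delta j l n ;
  delta_sum1 : forall j n, (0 < n)%N -> \sum_(l < n) delta j l n = 1 }.

Section Queueing.
Context {R : realType} {J I : finType} (N : network R J I).

Definition route (i : I) : seq J := first_queue N i :: next_queues N i.
Definition hop (i : I) (k : nat) : J := nth (first_queue N i) (route i) k.

Definition incidence : Type := {ji : J * I | ji.1 \in route ji.2}.

Definition counts : Type := {ffun incidence -> nat}.

Definition queue_total (m : counts) (j : J) : nat :=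
  (\sum_(k : incidence | (val k).1 == j) m k)%N.

Definition window_total (m : counts) (i : I) : nat :=
  (\sum_(k : incidence | (val k).2 == i) m k)%N.

Definition words : Type := {ffun J -> seq I}.

Definition state : Type :=
  {s : {ffun J -> seq I} | [forall j, all (fun i => j \in route i) (s j)]}.

Definition counts_of (s : state) : counts :=
  [ffun k : incidence => count_mem (val k).2 (val s (val k).1)].

Definition insert_packet (w : words) (j : J) (l : nat) (i : I) : words :=
  [ffun j' => if j' == j then take l (w j) ++ i :: drop l (w j) else w j'].

Definition remove_packet (w : words) (j : J) (l : nat) : words :=
  [ffun j' => if j' == j then take l (w j) ++ drop l.+1 (w j) else w j'].

(* [fine] is harmless here: G_i is finite on the integers. *)
Definition injection_intensity (G : I -> R -> \bar R) (i : I) (k : nat) : R :=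
  expR (fine (G i k.+1%:R) - fine (G i k%:R)).

Definition injection_rate (G : I -> R -> \bar R) (s s' : state) : R :=
  \sum_(i : I)
    let j := hop i 0 in let w := val s in
    \sum_(l < (size (w j)).+1 | val s' == insert_packet w j l i)
      injection_intensity G i (window_total (counts_of s) i)
        * delta N j l (size (w j)).+1.

(* The queues of a route are distinct, so j' is not affected by the removal of
   the packet from j. *)
Definition transfer_rate (s s' : state) : R :=
  \sum_(i : I) \sum_(k < size (next_queues N i))
    let j := hop i k in let j' := hop i k.+1 in let w := val s in
    \sum_(l < size (w j) | onth (w j) l == Some i)
    \sum_(l' < (size (w j')).+1
            | val s' == insert_packet (remove_packet w j l) j' l' i)
      capacity N j * gamma N j l (size (w j)) * delta N j' l' (size (w j')).+1.

Definition acknowledgement_rate (s s' : state) : R :=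
  \sum_(i : I)
    let j := hop i (size (next_queues N i)) in let w := val s in
    \sum_(l < size (w j) | (onth (w j) l == Some i)
                           && (val s' == remove_packet w j l))
      capacity N j * gamma N j l (size (w j)).

Definition rate (G : I -> R -> \bar R) (s s' : state) : R :=
  injection_rate G s s' + transfer_rate s s' + acknowledgement_rate s s'.

Definition weight (G : I -> R -> \bar R) (m : counts) : R :=
  (\prod_(j : J)
     ((queue_total m j)`!%:R / (\prod_(k : incidence | (val k).1 == j) (m k)`!)%N%:R
      * (1 / capacity N j ^+ queue_total m j)))
  * \prod_(i : I) expR (fine (G i (window_total m i)%:R)).

Definition normalizer (G : I -> R -> \bar R) : \bar R :=
  \esum_(m in [set: counts]) (weight G m)%:E.

End Queueing.

(* Main.v *)
(* Give a state the weight prod_j C_j^(-m_j) * prod_i e^(G_i (window i)), whatever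
   the order of the packets.  The time-reversed process with respect to this measure is again a
   network of the same kind, with the routes reversed and gamma, delta exchanged;
   since it leaves a state at the same total rate as the original one, the measure
   is invariant.  Summing over the orderings of the packets produces the
   multinomial coefficients.

   Uniqueness, and finiteness of the normalizer, do not need recurrence.  Concavity
   bounds the injection rates, so the exit rates are bounded; the stationary p
   satisfies sum_s p(s) q(s,u) <= p(u) exit(u) by letting t -> 0+, and a summable
   excessive measure is invariant.  The empty state is reachable from every state,
   hence an excessive measure vanishing there vanishes identically.  If pi is the
   product measure and c = pi(empty) / p(empty), apply this to c p - min(pi, c p)
   and then to pi - c p: both vanish at the empty state, so pi = c p and the
   normalizer is c. *)
Require Import Defs.
From HB Require Import structures.
From mathcomp Require Import all_boot all_order all_algebra.
From mathcomp Require Import all_classical all_reals all_analysis.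
From mathcomp Require Import ring lra zify.

Set Implicit Arguments.
Unset Strict Implicit.
Unset Printing Implicit Defensive.

Import Order.TTheory GRing.Theory Num.Theory.
Import numFieldNormedType.Exports.

Local Open Scope classical_set_scope.
Local Open Scope ring_scope.

(** * Excessive and invariant measures of Markov chains with bounded rates *)

Section ExtendedSums.
Context {R : realType}.
Implicit Types S T : choiceType.

Lemma esum_exchange S T (a : S -> T -> \bar R) :
  (forall s t, 0 <= a s t)%E ->
  (\esum_(s in [set: S]) \esum_(t in [set: T]) a s t =
   \esum_(t in [set: T]) \esum_(s in [set: S]) a s t)%E.
Proof.
move=> a0; rewrite !esum_esum//.
rewrite (@reindex_esum _ _ _ ([set: T] `*`` fun=> [set: S]) _ (fun k => (k.2, k.1)))//.
split=> //; first by move=> [t s] [t' s'] _ _ [-> ->].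
by move=> [s t] _; exists (t, s).
Qed.

Lemma esum_le_seq S (a : S -> R) (x : R) :
  (forall r : seq S, uniq r -> \sum_(s <- r) a s <= x) ->
  (\esum_(s in [set: S]) (a s)%:E <= x%:E)%E.
Proof.
move=> ax; apply: ge_ereal_sup => _ [X [finX _] <-].
by rewrite fsbig_finite// sumEFin lee_fin ax// finmap.fset_uniq.
Qed.

Lemma seq_le_esum S (a : S -> R) (r : seq S) : (forall s, 0 <= a s) -> uniq r ->
  ((\sum_(s <- r) a s)%:E <= \esum_(s in [set: S]) (a s)%:E)%E.
Proof.
move=> a0 ur; apply: esum_ge; exists [set` r].
  by split=> //; exact: finite_seq.
by rewrite -fsbig_seq// sumEFin.
Qed.

Lemma esumZ S (c : R) (a : S -> \bar R) : 0 <= c -> (forall s, 0 <= a s)%E ->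
  (\esum_(s in [set: S]) (c%:E * a s) = c%:E * \esum_(s in [set: S]) a s)%E.
Proof.
rewrite le_eqVlt => /predU1P[<-|c0] a0.
  by rewrite mul0e esum1// => s _; rewrite mul0e.
have le (d : R) (b : S -> \bar R) : 0 < d -> (forall s, 0 <= b s)%E ->
    (\esum_(s in [set: S]) (d%:E * b s) <= d%:E * \esum_(s in [set: S]) b s)%E.
  move=> d0 b0; apply: ge_ereal_sup => _ [X XS <-].
  rewrite -ge0_mule_fsumr//; apply: lee_wpmul2l; first by rewrite lee_fin ltW.
  by apply: ereal_sup_ubound; exists X.
apply/eqP; rewrite eq_le le//=.
have ca0 s : (0 <= c%:E * a s)%E by apply: mule_ge0 => //; rewrite lee_fin ltW.
have cV0 : 0 < c^-1 by rewrite invr_gt0.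
(* The reverse inequality is [le] again, for the constant [c^-1] and the family [c * a]. *)
have := le _ (fun s => c%:E * a s)%E cV0 ca0.
rewrite (eq_esum (b := a)); last first.
  by move=> s _; rewrite muleA -EFinM mulVf ?gt_eqF// mul1e.
move=> /(lee_wpmul2l (_ : 0 <= c%:E)%E); rewrite lee_fin (ltW c0) => /(_ isT).
by rewrite muleA -EFinM mulfV ?gt_eqF// mul1e.
Qed.

Lemma esum_single S (s0 : S) (a : S -> \bar R) : (0 <= a s0)%E ->
  (forall s, s != s0 -> a s = 0%E) -> \esum_(s in [set: S]) a s = a s0.
Proof.
move=> a0 az; rewrite -(esum_set1 a0) [RHS]esum_mkcond; apply: eq_esum => s _.
by case: ifPn => //; rewrite notin_setE => /= /eqP/az.
Qed.

(** Finiteness of the sum of [a] allows its cancellation, so the non-negative differences [b - a]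
    have sum at most 0 and each one vanishes. *)
Lemma esum_le_eq S (a b : S -> R) : (forall s, 0 <= a s <= b s) ->
  (\esum_(s in [set: S]) (b s)%:E <= \esum_(s in [set: S]) (a s)%:E)%E ->
  (\esum_(s in [set: S]) (a s)%:E < +oo)%E -> a = b.
Proof.
move=> ab ba aoo; apply/funext => s; apply/eqP.
have a0 t : 0 <= a t by case/andP: (ab t).
have d0 t : 0 <= b t - a t by rewrite subr_ge0; case/andP: (ab t).
have afin : \esum_(s in [set: S]) (a s)%:E \is a fin_num.
  by rewrite ge0_fin_numE//; apply: esum_ge0 => ? _; rewrite lee_fin.
move: ba; rewrite (eq_esum (b := fun t => (a t)%:E + (b t - a t)%:E)%E); last first.
  by move=> t _; rewrite -EFinD addrC subrK.
rewrite esumD//; last 2 first.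
- by move=> ? _; rewrite lee_fin.
- by move=> ? _; rewrite lee_fin.
rewrite -leeBrDl// subee// => le0.
have : (\esum_(t in [set s]) (b t - a t)%:E <= 0)%E.
  apply: le_trans le0; rewrite esum_mkcond; apply: le_esum => t _.
  by case: ifP => // _; rewrite lee_fin.
by rewrite esum_set1 ?lee_fin// subr_le0 eq_le => ->; case/andP: (ab s) => _ ->.
Qed.

End ExtendedSums.

Section ExcessiveMeasures.
Context {R : realType} {S : choiceType} (q : S -> S -> R).
Hypothesis q_ge0 : forall s u, 0 <= q s u.
Hypothesis q_diag : forall s, q s s = 0.

Definition excessive (nu : S -> R) : Prop := (forall s, 0 <= nu s) /\
  forall u, (\esum_(s in [set: S]) (nu s * q s u)%:E <= (nu u * exit_rate q u)%:E)%E.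

Definition invariant_measure (nu : S -> R) : Prop := (forall s, 0 <= nu s) /\
  forall u, \esum_(s in [set: S]) (nu s * q s u)%:E = (nu u * exit_rate q u)%:E.

Lemma exit_rateE s :
  exit_rate q s = fine (\esum_(u in [set: S]) (q s u)%:E).
Proof.
congr fine; rewrite esum_mkcond; apply: eq_esum => u _.
by case: ifPn => //; rewrite notin_setE /= => /negP/negPn/eqP ->; rewrite q_diag.
Qed.

(** A finite part of the identity [p P_t = p] at [u] is an inequality, and only finite sums are
    passed to the limit t -> 0+ of (P_t - 1) / t. This is why the conclusion is excessive rather
    than invariant. *)
Lemma stationary_excessive (P : R -> S -> S -> R) (p : S -> R) :
  is_transition_function q P -> is_stationary P p -> excessive p.
Proof.
move=> PP [[p0 _] pP]; split=> // u; apply: esum_le_seq => r ur.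
(* The diagonal term at [u], the source of the exit rate, must be present whether or not [r]
   contains [u]. *)
pose r' := u :: rem u r.
have ur' : uniq r' by rewrite /= rem_uniq// mem_rem_uniqF.
have sum_le t : 0 < t ->
    \sum_(s <- r') p s * ((P t s u - (s == u)%:R) / t) <= 0.
  move=> t0; under eq_bigr do rewrite mulrA mulrBr.
  rewrite -mulr_suml pmulr_lle0 ?invr_gt0// sumrB [X in _ - X]big_cons.
  rewrite eqxx mulr1 [X in _ - (_ + X)]big1_seq ?addr0; last first.
    move=> s /andP[_ sr]; have /= /andP[+ _] := ur'.
    by case: eqP sr => [-> ->|]; rewrite ?mulr0.
  rewrite subr_le0 -lee_fin -(pP t u (ltW t0)); apply: seq_le_esum => // s.
  by rewrite mulr_ge0// (tf_ge0 PP)// ltW.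
have sum_cvg : \sum_(s <- r') p s * ((P t s u - (s == u)%:R) / t) @[t --> 0^'+]
    --> \sum_(s <- r') p s * q_matrix q s u.
  apply: cvg_big => [|s _]; first exact: add_continuous.
  by apply: cvgMr; exact: (tf_rates PP).
have : \sum_(s <- r') p s * q_matrix q s u <= 0.
  apply: (ler_cvg_to sum_cvg (cvg_cst 0)).
  by near=> t; apply: sum_le; near: t; exact: nbhs_right_gt.
rewrite big_cons {1}/q_matrix eqxx mulrN addrC subr_le0; apply: le_trans.
have -> : \sum_(s <- rem u r) p s * q_matrix q s u = \sum_(s <- rem u r) p s * q s u.
  apply: eq_big_seq => s sr; rewrite /q_matrix; case: eqP => // su.
  by move: ur' sr; rewrite /= su => /andP[/negPf->].
(* Dropping [u] from [r] does not change the inflow, since [q u u = 0]. *)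
have [ru|ru] := boolP (u \in r); last by rewrite rem_id.
by rewrite (perm_big _ (perm_to_rem ru))/= big_cons q_diag mulr0 add0r.
Unshelve. all: by end_near. Qed.

Context (L : R).
Hypothesis q_bounded : forall s, (\esum_(u in [set: S]) (q s u)%:E <= L%:E)%E.

Lemma exit_rate_esum s : (exit_rate q s)%:E = \esum_(u in [set: S]) (q s u)%:E.
Proof.
rewrite exit_rateE fineK// ge0_fin_numE; first exact: le_lt_trans (ltry _).
by apply: esum_ge0 => u _; rewrite lee_fin.
Qed.

Lemma exit_rate_ge0 s : 0 <= exit_rate q s.
Proof.
by rewrite -lee_fin exit_rate_esum esum_ge0// => u _; rewrite lee_fin.
Qed.

(** The inflow [a] is at most the outflow [b] at each state. Their totals agree, and are finite
    because [nu] is summable and the exit rates are at most [L]; hence [a = b]. *)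
Lemma excessive_invariant nu :
  excessive nu -> (\esum_(s in [set: S]) (nu s)%:E < +oo)%E -> invariant_measure nu.
Proof.
move=> [nu0 nuq] nuoo; split=> // u.
pose b u := nu u * exit_rate q u.
have nuq0 s t : 0 <= nu s * q s t by exact: mulr_ge0.
pose a u := fine (\esum_(s in [set: S]) (nu s * q s u)%:E).
have aE u' : \esum_(s in [set: S]) (nu s * q s u')%:E = (a u')%:E.
  rewrite fineK// ge0_fin_numE; first exact: le_lt_trans (nuq u') (ltry _).
  by apply: esum_ge0 => s _; rewrite lee_fin.
have ab u' : 0 <= a u' <= b u'.
  rewrite -!lee_fin -aE nuq andbT.
  by apply: esum_ge0 => s _; rewrite lee_fin.
suff: a = b by rewrite aE => ->.
(* Exchanging the sums counts each jump by its source instead of its target. *)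
have aEb : \esum_(u in [set: S]) (a u)%:E = \esum_(u in [set: S]) (b u)%:E.
  under eq_esum do rewrite -aE.
  rewrite esum_exchange; last by move=> *; rewrite lee_fin.
  apply: eq_esum => s _; rewrite /b EFinM exit_rate_esum -esumZ//.
  by move=> t; rewrite lee_fin.
apply: esum_le_eq => //; first by rewrite aEb.
rewrite aEb; apply: (@le_lt_trans _ _ (L%:E * \esum_(s in [set: S]) (nu s)%:E)%E).
  rewrite -esumZ; last 2 first.
  - by rewrite -lee_fin (le_trans _ (q_bounded u))// esum_ge0// => t _; rewrite lee_fin.
  - by move=> s; rewrite lee_fin.
  apply: le_esum => s _; rewrite /b -EFinM mulrC lee_fin ler_wpM2r//.
  by rewrite -lee_fin exit_rate_esum.
by rewrite lte_mul_pinfty// (le_trans _ (q_bounded u))// esum_ge0// => t _; rewrite lee_fin.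
Qed.

(** Reachability of [e] from every state, encoded by a height [V] that some jump of positive rate
    lowers. *)
Context (e : S) (V : S -> nat).
Hypothesis V_decr : forall s, s != e -> exists2 u, 0 < q s u & (V u < V s)%N.

(** If [nu u = 0], then the inflow into [u] is 0, so every state that jumps to [u] has measure 0.
    Induction on [V] spreads this from [e] to all states. *)
Lemma excessive_eq0 nu : excessive nu -> nu e = 0 -> forall s, nu s = 0.
Proof.
move=> [nu0 nuq] nue s; have [n] := ubnP (V s); elim: n s => // n IH s Vs.
have [->//|/V_decr[u qsu Vus]] := eqVneq s e.
have nuu : nu u = 0 by apply: IH; exact: leq_trans Vus Vs.
have := @seq_le_esum _ _ (fun s => nu s * q s u) [:: s] _ isT.
rewrite big_seq1 => /(_ (fun s => mulr_ge0 (nu0 s) (q_ge0 s u))).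
move=> /le_trans/(_ (nuq u)); rewrite nuu mul0r lee_fin pmulr_lle0// => le0.
by apply/eqP; rewrite eq_le le0/=.
Qed.

Lemma excessive_stationary_proportional (P : R -> S -> S -> R) (pi p : S -> R) :
  is_transition_function q P -> is_stationary P p -> excessive pi ->
  0 < p e /\ forall s, pi s = pi e / p e * p s.
Proof.
move=> PP pstat piX; have pX := stationary_excessive PP pstat.
have [[p0 p1] _] := pstat; have [pi0 piq] := piX.
have pe : 0 < p e.
  (* If [p e] were 0, then [p] would vanish identically, against its total mass 1. *)
  rewrite lt_neqAle p0 andbT eq_sym; apply: contra_eq_neq p1.
  move=> /(excessive_eq0 pX) p_0; rewrite esum1; last by move=> s _; rewrite p_0.
  by rewrite eq_sym onee_neq0.
split=> //; set c := pi e / p e; have c0 : 0 <= c by rewrite divr_ge0.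
(* The constant [c] makes [pi] and [c * p] agree at [e]. The minimum is summable because [c * p] is,
   although [pi] is not known to be. *)
pose h s := Num.min (pi s) (c * p s).
have h0 s : 0 <= h s by rewrite le_min pi0 mulr_ge0.
have cpq u : (\esum_(s in [set: S]) (c * p s * q s u)%:E <=
              (c * p u * exit_rate q u)%:E)%E.
  rewrite -mulrA EFinM; apply: le_trans (lee_wpmul2l _ (pX.2 u)); last first.
    by rewrite lee_fin.
  rewrite -esumZ//; last by move=> s; rewrite lee_fin mulr_ge0.
  by apply: le_esum => s _; rewrite -EFinM mulrA.
have hX : excessive h.
  split=> // u; rewrite /h minr_pMl ?exit_rate_ge0// EFin_min le_min.
  apply/andP; split; [apply: le_trans (piq u)|apply: le_trans (cpq u)];
    apply: le_esum => s _; rewrite lee_fin ler_wpM2r// ge_min lexx ?orbT//.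
have hoo : (\esum_(s in [set: S]) (h s)%:E < +oo)%E.
  apply: (@le_lt_trans _ _ (c%:E * 1)%E); last by rewrite mule1 ltry.
  rewrite -p1 -esumZ//.
  by apply: le_esum => s _; rewrite -EFinM lee_fin ge_min lexx orbT.
have [_ hq] := excessive_invariant hX hoo.
(* As [h] is invariant, subtracting it from an excessive measure above it leaves an excessive
   measure; that one vanishes at [e], hence everywhere. This is applied to [pi] and to [c * p]. *)
have subX nu : (forall u, (\esum_(s in [set: S]) (nu s * q s u)%:E <=
      (nu u * exit_rate q u)%:E)%E) -> (forall s, h s <= nu s) ->
    nu e = h e -> forall s, nu s = h s.
  move=> nuq hnu nue s; apply/eqP; rewrite -subr_eq0; apply/eqP; move: s.
  apply: (@excessive_eq0 (fun s => nu s - h s)); last by rewrite nue subrr.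
  split=> [s|u]; first by rewrite subr_ge0.
  rewrite -(@leeD2lE _ (h u * exit_rate q u)%:E)// -{1}hq -EFinD.
  rewrite -esumD; last 2 first.
  - by move=> s _; rewrite lee_fin mulr_ge0.
  - by move=> s _; rewrite lee_fin mulr_ge0// subr_ge0.
  rewrite mulrBl addrC subrK; apply: le_trans (nuq u).
  by apply: le_esum => s _; rewrite -EFinD mulrBl addrC subrK.
have he : h e = pi e by rewrite /h /c divfK ?gt_eqF// minxx.
move=> s; rewrite (subX pi)//; last by move=> ?; rewrite ge_min lexx.
rewrite -(subX (fun s => c * p s))// => [t|]; first by rewrite ge_min lexx orbT.
by rewrite he /c divfK ?gt_eqF.
Qed.

End ExcessiveMeasures.

(** * Transition rates on words *)

(** Queue lengths differ before and after a jump, so the two index ranges differ; only the bound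
    together with the predicate has to match. *)
Lemma eq_big_ord_cond (R : Type) (idx : R) (op : Monoid.com_law idx)
    (m n : nat) (P Q : pred nat) (F F' : nat -> R) :
  (forall l, (l < m)%N && P l = (l < n)%N && Q l) ->
  (forall l, (l < m)%N -> P l -> F l = F' l) ->
  \big[op/idx]_(l < m | P l) F l = \big[op/idx]_(l < n | Q l) F' l.
Proof.
move=> PQ FF'; rewrite (big_ord_widen_cond _ P F (leq_maxl m n)).
rewrite (big_ord_widen_cond _ Q F' (leq_maxr m n)).
apply: eq_big => [l|l /andP[Pl lm]]; first by rewrite andbC PQ andbC.
exact: FF'.
Qed.

Section Words.
Context {J I : finType}.
Implicit Types (w : @words J I) (j : J) (i : I).

Lemma seq_insertE (s s' : seq I) l i :
  (l < (size s).+1)%N && (s' == take l s ++ i :: drop l s) =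
  (l < size s')%N && ((onth s' l == Some i) && (s == take l s' ++ drop l.+1 s')).
Proof.
apply/andP/andP => [[ls /eqP->]|[ls /andP[/eqP si /eqP->]]].
  have szl : size (take l s) = l by rewrite size_takel.
  rewrite size_cat szl /= -[X in (X < _)%N]addn0 ltn_add2l; split=> //.
  rewrite onth_cat szl ltnn subnn /= eqxx /=.
  by rewrite take_size_cat// -cat_rcons drop_size_cat ?size_rcons ?szl// cat_take_drop.
have szl : size (take l s') = l by rewrite size_takel// ltnW.
rewrite take_size_cat// drop_size_cat// size_cat szl ltnS leq_addr; split=> //.
rewrite -{1}(cat_take_drop l s') (drop_nth i)//.
by rewrite (@onth_nth _ i i s' l si).
Qed.

(** Insertion and removal at [l] undo each other, with the admissible ranges of [l] included. Time
    reversal of single events rests on this. *)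
Lemma insert_packetE w w' j l i :
  (l < (size (w j)).+1)%N && (w' == insert_packet w j l i) =
  (l < size (w' j))%N &&
    ((onth (w' j) l == Some i) && (w == remove_packet w' j l)).
Proof.
have eqE (u v : @words J I) : (u == v) = [forall j', u j' == v j'].
  by apply/eqP/forallP => [-> //|uv]; apply/ffunP => j'; apply/eqP.
(* Both equalities impose the same condition [off] away from queue [j]; at [j] they are compared by
   [seq_insertE]. *)
pose off := [forall (j' | j' != j), w j' == w' j'].
have -> : (w' == insert_packet w j l i) =
    (w' j == take l (w j) ++ i :: drop l (w j)) && off.
  rewrite eqE; apply/forallP/andP => [ww'|[wj /forallP woff] j'].
    split; first by have := ww' j; rewrite ffunE eqxx.
    apply/forallP => j'; apply/implyP => /negPf nj.
    by have := ww' j'; rewrite ffunE nj => /eqP->.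
  rewrite ffunE; case: (eqVneq j' j) => [->//|/negPf nj].
  by have := woff j'; rewrite nj/= => /eqP->.
have -> : (w == remove_packet w' j l) =
    (w j == take l (w' j) ++ drop l.+1 (w' j)) && off.
  rewrite eqE; apply/forallP/andP => [ww'|[wj /forallP woff] j'].
    split; first by have := ww' j; rewrite ffunE eqxx.
    by apply/forallP => j'; apply/implyP => /negPf nj; have := ww' j'; rewrite ffunE nj.
  rewrite ffunE; case: (eqVneq j' j) => [->//|/negPf nj].
  by have := woff j'; rewrite nj.
by rewrite !andbA seq_insertE !andbA.
Qed.

Lemma remove_packetK w j l i :
  onth (w j) l = Some i -> insert_packet (remove_packet w j l) j l i = w.
Proof.
move=> wl; have lw : (l < size (w j))%N by rewrite -onthTE wl.
have := insert_packetE (remove_packet w j l) w j l i.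
by rewrite lw wl !eqxx => /andP[_ /eqP<-].
Qed.

(** Stated for any commutative monoid, to serve the product in the weight as well as the sums in
    [window] and [remaining_hops]. *)
Lemma big_insert_packet (T : Type) (idx : T) (op : Monoid.com_law idx)
    (v : J -> I -> T) w j l i :
  \big[op/idx]_j' \big[op/idx]_(i' <- insert_packet w j l i j') v j' i' =
  op (v j i) (\big[op/idx]_j' \big[op/idx]_(i' <- w j') v j' i').
Proof.
rewrite (bigD1 j)//= [in RHS](bigD1 j)//= Monoid.mulmA; congr (op _ _).
  by rewrite ffunE eqxx -{3}(cat_take_drop l (w j)) !big_cat /= big_cons Monoid.mulmCA.
by apply: eq_bigr => j' /negPf nj; rewrite ffunE nj.
Qed.

Definition window w i : nat := (\sum_j count_mem i (w j))%N.

Lemma windowE w i : window w i = (\sum_j \sum_(i' <- w j) (i' == i))%N.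
Proof.
apply: eq_bigr => j _; rewrite -sum1_count big_mkcond.
by apply: eq_bigr => i' _ /=; case: (i' == i).
Qed.

Lemma window_insert w j l i i' :
  window (insert_packet w j l i) i' = ((i == i') + window w i')%N.
Proof. by rewrite !windowE (big_insert_packet _ (fun _ a => (a == i') : nat)). Qed.

End Words.

(** * Rates out of a state and their totals *)

Section Mass.
Context {R : realType} {S : choiceType}.

Definition mass (f : S -> R) (x : R) : Prop :=
  (forall s, 0 <= f s) /\ \esum_(s in [set: S]) (f s)%:E = x%:E.

Lemma mass_sum (A : choiceType) (r : seq A) (P : pred A) (f : A -> S -> R) (x : A -> R) :
  (forall a, P a -> mass (f a) (x a)) ->
  mass (fun s => \sum_(a <- r | P a) f a s) (\sum_(a <- r | P a) x a).
Proof.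
move=> fx; split=> [s|]; first by apply: sumr_ge0 => a /fx[].
under eq_esum do rewrite -sumEFin.
rewrite esum_sum; last by move=> s a _ /fx[]; rewrite lee_fin.
by rewrite -sumEFin; apply: eq_bigr => a /fx[].
Qed.

Lemma massD (f g : S -> R) x y :
  mass f x -> mass g y -> mass (fun s => f s + g s) (x + y).
Proof.
move=> [f0 fx] [g0 gy]; split=> [s|]; first exact: addr_ge0.
under eq_esum do rewrite EFinD.
by rewrite esumD ?fx ?gy//= => s _; rewrite lee_fin.
Qed.

Lemma massZ c (f : S -> R) x : 0 <= c -> mass f x -> mass (fun s => c * f s) (c * x).
Proof.
move=> c0 [f0 fx]; split=> [s|]; first exact: mulr_ge0.
by under eq_esum do rewrite EFinM; rewrite esumZ ?fx.
Qed.

End Mass.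

Section Rates.
Context {R : realType} {J I : finType} (N : network R J I) (G : I -> R -> \bar R).
Implicit Types (w u : @words J I) (s : state N).

Definition routed w := [forall j, all (fun i => j \in route N i) (w j)].

Lemma routed_insert w j l i : j \in route N i -> routed w -> routed (insert_packet w j l i).
Proof.
move=> ji /forallP wr; apply/forallP => j'; rewrite ffunE; case: eqVneq => // ->.
by rewrite all_cat/= ji/= -all_cat cat_take_drop.
Qed.

Lemma routed_remove w j l : routed w -> routed (remove_packet w j l).
Proof.
move=> /forallP wr; apply/forallP => j'; rewrite ffunE; case: eqVneq => // ->.
by rewrite all_cat; apply/andP; split; apply/allP => i;
  [move/mem_take|move/mem_drop]; exact: (allP (wr j)).
Qed.

Lemma routed_state s : routed (val s). Proof. exact: valP. Qed.

(** Each [l] contributes a point mass [r l] at the state [T l]; coinciding targets simply add up. *)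
Lemma mass_dirac (n : nat) (P : pred nat) (T : nat -> @words J I) (r : nat -> R) :
  (forall l, (l < n)%N -> P l -> routed (T l) /\ 0 <= r l) ->
  mass (fun s => \sum_(l < n | P l && (val s == T l)) r l) (\sum_(l < n | P l) r l).
Proof.
move=> Tr.
have -> : (fun s => \sum_(l < n | P l && (val s == T l)) r l) =
    fun s => \sum_(l < n | P l) if val s == T l then r l else 0.
  by apply/funext => s; rewrite big_mkcondr.
apply: mass_sum => l Pl; have [Trl r0] := Tr l (ltn_ord l) Pl.
split=> [s|]; first by case: ifP.
rewrite (@esum_single _ _ (Sub (T l) Trl : state N)) ?SubK ?eqxx//.
by move=> s /negPf; rewrite -val_eqE /= => ->.
Qed.

Section GeneralRates.
Variables (h : I -> nat -> J) (phi psi : J -> nat -> nat -> R).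
Hypothesis phi_ge0 : forall j l n, (l < n)%N -> 0 <= phi j l n.
Hypothesis phi_sum1 : forall j n, (0 < n)%N -> \sum_(l < n) phi j l n = 1.
Hypothesis psi_ge0 : forall j l n, (l < n)%N -> 0 <= psi j l n.
Hypothesis psi_sum1 : forall j n, (0 < n)%N -> \sum_(l < n) psi j l n = 1.
(** A permutation is asked for rather than an equality, so that the reversed routes qualify too. *)
Hypothesis h_route : forall i,
  perm_eq [seq h i (k : 'I__) | k <- enum 'I_(size (next_queues N i)).+1] (route N i).

(* [rate] transposed to words, for routes [h], service proportions [phi] and
   insertion probabilities [psi]: reversing the routes and exchanging [phi] and
   [psi] gives the rates of the time-reversed chain. *)
Definition word_rate w u : R :=
  \sum_i \sum_(l < (size (w (h i 0))).+1 | u == insert_packet w (h i 0) l i)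
      injection_intensity G i (window w i) * psi (h i 0) l (size (w (h i 0))).+1
  + \sum_i \sum_(k < size (next_queues N i))
      \sum_(l < size (w (h i k)) | onth (w (h i k)) l == Some i)
      \sum_(l' < (size (w (h i k.+1))).+1
            | u == insert_packet (remove_packet w (h i k) l) (h i k.+1) l' i)
      capacity N (h i k) * phi (h i k) l (size (w (h i k)))
        * psi (h i k.+1) l' (size (w (h i k.+1))).+1
  + \sum_i \sum_(l < size (w (h i (size (next_queues N i))))
        | (onth (w (h i (size (next_queues N i)))) l == Some i)
            && (u == remove_packet w (h i (size (next_queues N i))) l))
      capacity N (h i (size (next_queues N i)))
        * phi (h i (size (next_queues N i))) l (size (w (h i (size (next_queues N i))))).

(** This does not involve [h], [phi] or [psi]: the chain and its time reversal leave a state at the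
    same rate. *)
Definition total_rate w : R :=
  \sum_i injection_intensity G i (window w i)
  + \sum_j (if (0 < size (w j))%N then capacity N j else 0).

Lemma h_in_route i k : (k <= size (next_queues N i))%N -> h i k \in route N i.
Proof.
rewrite -ltnS => kn; rewrite -(perm_mem (h_route i)).
by apply/mapP; exists (Ordinal kn) => //; rewrite mem_enum.
Qed.

(** Each position of a queue holds exactly one packet and is counted for the route of that packet
    only. The proportions sum to 1, so a non-empty queue works at its full capacity. *)
Lemma service_total w : routed w ->
  \sum_i \sum_(k < (size (next_queues N i)).+1)
     \sum_(l < size (w (h i k)) | onth (w (h i k)) l == Some i)
       capacity N (h i k) * phi (h i k) l (size (w (h i k))) =
  \sum_j (if (0 < size (w j))%N then capacity N j else 0).
Proof.
move=> /forallP wr.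
pose F i j := \sum_(l < size (w j) | onth (w j) l == Some i)
       capacity N j * phi j l (size (w j)).
transitivity (\sum_i \sum_j F i j).
  apply: eq_bigr => i _.
  transitivity (\sum_(j <- [seq h i (k : 'I__)
      | k <- enum 'I_(size (next_queues N i)).+1]) F i j).
    by rewrite big_map big_enum.
  rewrite (perm_big _ (h_route i)) big_uniq ?route_uniq//= big_mkcond/=.
  apply: eq_bigr => j _; case: ifPn => // ji; rewrite /F big1// => l /eqP wl.
  have /(allP (wr j)) : i \in w j by apply/onthP; exists l.
  by rewrite (negPf ji).
rewrite exchange_big; apply: eq_bigr => j _; rewrite /F.
under eq_bigr do rewrite big_mkcond.
rewrite exchange_big/=.
under eq_bigr => l _.
  have := ltn_ord l; rewrite -onthTE; case wl : onth => [i|]// _.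
  rewrite -big_mkcond (big_pred1 i); last by move=> i'; rewrite /= (inj_eq Some_inj) eq_sym.
  over.
by rewrite -mulr_sumr; case: posnP => [->|n0]; rewrite ?big_ord0 ?mulr0// phi_sum1// mulr1.
Qed.

Lemma word_rate_mass s :
  mass (fun s' : state N => word_rate (val s) (val s')) (total_rate (val s)).
Proof.
rewrite /total_rate -service_total; last exact: routed_state.
set w := val s.
have -> : \sum_i injection_intensity G i (window w i) =
    \sum_i \sum_(l < (size (w (h i 0))).+1)
      injection_intensity G i (window w i) * psi (h i 0) l (size (w (h i 0))).+1.
  by apply: eq_bigr => i _; rewrite -mulr_sumr psi_sum1// mulr1.
have g0 i k : 0 <= injection_intensity G i k by exact: expR_ge0.
(* The last hop gives the acknowledgements, the earlier ones the transfers. *)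
under [X in _ + X]eq_bigr do rewrite big_ord_recr/=.
rewrite big_split addrA/=; apply: massD; first apply: massD.
- apply: mass_sum => i _; apply: (mass_dirac (P := xpredT)
    (T := fun l => insert_packet w (h i 0) l i)
    (r := fun l => _ * psi (h i 0) l (size (w (h i 0))).+1)) => l ls _.
  split; last by rewrite mulr_ge0// psi_ge0.
  by apply: routed_insert (routed_state s); exact: h_in_route.
- apply: mass_sum => i _; apply: mass_sum => k _; apply: mass_sum => l _.
  (* The factor 1 is expanded into the insertion probabilities at the next queue. *)
  rewrite -[X in mass _ X]mulr1 -(psi_sum1 (h i k.+1) (ltn0Sn (size (w (h i k.+1))))).
  rewrite mulr_sumr; apply: (mass_dirac (P := xpredT)
    (T := fun l' => insert_packet (remove_packet w (h i k) l) (h i k.+1) l' i)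
    (r := fun l' => _ * psi (h i k.+1) l' (size (w (h i k.+1))).+1)) => l' ls _.
  split; last by rewrite !mulr_ge0// ?psi_ge0// ?phi_ge0// ltW// capacity_gt0.
  apply: routed_insert; first exact: h_in_route.
  exact: routed_remove (routed_state s).
- apply: mass_sum => i _.
  pose j := h i (size (next_queues N i)).
  apply: (mass_dirac (P := fun l => onth (w j) l == Some i)
    (T := fun l => remove_packet w j l)
    (r := fun l => _ * phi j l (size (w j)))) => l ls _.
  split; last by rewrite mulr_ge0// ?phi_ge0// ltW// capacity_gt0.
  exact: routed_remove (routed_state s).
Qed.

End GeneralRates.

End Rates.

(** * Time reversal *)

Lemma big_ord_nestedE (R : Type) (idx : R) (op : Monoid.com_law idx)
    (a b M : nat) (P : pred nat) (Q : rel nat) (F : nat -> nat -> R) :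
  (a <= M)%N -> (b <= M)%N ->
  \big[op/idx]_(l < a | P l) \big[op/idx]_(l' < b | Q l l') F l l' =
  \big[op/idx]_(l < M) \big[op/idx]_(l' < M)
    (if ((l < a)%N && P l) && ((l' < b)%N && Q l l') then F l l' else idx).
Proof.
move=> aM bM.
rewrite (big_ord_widen_cond _ P (fun l => \big[op/idx]_(l' < b | Q l l') F l l') aM).
rewrite big_mkcond; apply: eq_bigr => l _; rewrite andbC.
case: ((l < a)%N && P l) => /=; last by rewrite big1.
rewrite (big_ord_widen_cond _ (Q l) (F l) bM) big_mkcond.
by apply: eq_bigr => l' _; rewrite andbC.
Qed.

(** Sums with four different bounds are exchanged by extending all of them to a common bound [M]. *)
Lemma exchange_big_ord_cond (R : Type) (idx : R) (op : Monoid.com_law idx)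
    (a b a' b' : nat) (P P' : pred nat) (Q Q' : rel nat) (F F' : nat -> nat -> R) :
  (forall l l', ((l < a)%N && P l) && ((l' < b)%N && Q l l') =
                ((l' < b')%N && P' l') && ((l < a')%N && Q' l' l)) ->
  (forall l l', (l < a)%N && P l -> (l' < b)%N && Q l l' -> F l l' = F' l' l) ->
  \big[op/idx]_(l < a | P l) \big[op/idx]_(l' < b | Q l l') F l l' =
  \big[op/idx]_(l' < b' | P' l') \big[op/idx]_(l < a' | Q' l' l) F' l' l.
Proof.
move=> PQ FF'; pose M := maxn (maxn a b) (maxn a' b').
rewrite (@big_ord_nestedE _ _ _ a b M) ?leq_max ?leqnn ?orbT//.
rewrite (@big_ord_nestedE _ _ _ b' a' M) ?leq_max ?leqnn ?orbT//.
rewrite exchange_big; apply: eq_bigr => l' _; apply: eq_bigr => l _.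
by rewrite -PQ; case: ifP => // /andP[] /FF' FF /FF.
Qed.

Section Balance.
Context {R : realType} {J I : finType} (N : network R J I) (G : I -> R -> \bar R).
Implicit Types (w u v : @words J I) (s : state N).

(** The powers of the capacities are written packet by packet, in the form that [big_insert_packet]
    handles. *)
Definition word_weight w : R :=
  (\prod_j \prod_(i <- w j) (capacity N j)^-1)
  * \prod_i expR (fine (G i (window w i)%:R)).

Lemma word_weight_gt0 w : 0 < word_weight w.
Proof.
apply: mulr_gt0; last by apply: prodr_gt0 => i _; exact: expR_gt0.
by apply: prodr_gt0 => j _; apply: prodr_gt0 => i _; rewrite invr_gt0 capacity_gt0.
Qed.

(** The new packet brings a factor 1 / C_j and raises window [i] by one; the exponential of that
    increment of [G i] is the injection intensity. *)
Lemma word_weight_insert w j l i :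
  word_weight (insert_packet w j l i) * capacity N j =
  word_weight w * injection_intensity G i (window w i).
Proof.
rewrite /word_weight.
rewrite (big_insert_packet _ (fun j (_ : I) => (capacity N j)^-1))/=.
rewrite (bigD1 i)//= [X in _ = _ * X * _](bigD1 i)//= window_insert eqxx add1n.
rewrite (eq_bigr (fun i' => expR (fine (G i' (window w i')%:R)))); last first.
  by move=> i' /negPf ni; rewrite window_insert eq_sym ni.
rewrite /injection_intensity expRB.
have C0 : capacity N j != 0 by rewrite gt_eqF// capacity_gt0.
have E0 : expR (fine (G i (window w i)%:R)) != 0 by rewrite gt_eqF// expR_gt0.
by field; rewrite C0 E0.
Qed.

(** Injections are paired with acknowledgements of the reversed network, where [psi] acts as service
    proportion. *)
Lemma insert_balance (psi : J -> nat -> nat -> R) w u i j :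
  word_weight w *
    (\sum_(l < (size (w j)).+1 | u == insert_packet w j l i)
       injection_intensity G i (window w i) * psi j l (size (w j)).+1) =
  word_weight u *
    (\sum_(l < size (u j) | (onth (u j) l == Some i) && (w == remove_packet u j l))
       capacity N j * psi j l (size (u j))).
Proof.
rewrite !mulr_sumr.
apply: (@eq_big_ord_cond _ _ _ _ _ (fun l => u == insert_packet w j l i)
  (fun l => (onth (u j) l == Some i) && (w == remove_packet u j l))
  (fun l => _ * (_ * psi j l _)) (fun l => _ * (_ * psi j l _))).
  by move=> l; exact: insert_packetE.
move=> l lw /eqP ->; rewrite !mulrA word_weight_insert ffunE eqxx.
by rewrite size_cat /= addnS -size_cat cat_take_drop.
Qed.

Lemma size_remove_neq w j l j' : j' != j -> size (remove_packet w j l j') = size (w j').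
Proof. by move=> /negPf nj; rewrite ffunE nj. Qed.

Lemma size_insert w j l i j' :
  size (insert_packet w j l i j') = ((j' == j) + size (w j'))%N.
Proof.
rewrite ffunE; case: eqVneq => [->|//].
by rewrite size_cat /= addnS -size_cat cat_take_drop.
Qed.

Lemma transfer_balance (phi psi : J -> nat -> nat -> R) w u i j j' : j != j' ->
  word_weight w *
    (\sum_(l < size (w j) | onth (w j) l == Some i)
     \sum_(l' < (size (w j')).+1
            | u == insert_packet (remove_packet w j l) j' l' i)
      capacity N j * phi j l (size (w j)) * psi j' l' (size (w j')).+1) =
  word_weight u *
    (\sum_(l' < size (u j') | onth (u j') l' == Some i)
     \sum_(l < (size (u j)).+1
            | w == insert_packet (remove_packet u j' l') j l i)
      capacity N j' * psi j' l' (size (u j')) * phi j l (size (u j)).+1).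
Proof.
move=> jj'; rewrite !mulr_sumr.
under eq_bigr do rewrite mulr_sumr.
under [RHS]eq_bigr do rewrite mulr_sumr.
apply: (@exchange_big_ord_cond _ _ _ _ _ _ _
  (fun l => onth (w j) l == Some i) (fun l' => onth (u j') l' == Some i)
  (fun l l' => u == insert_packet (remove_packet w j l) j' l' i)
  (fun l' l => w == insert_packet (remove_packet u j' l') j l i)
  (fun l l' => _ * (_ * phi j l _ * psi j' l' _))
  (fun l' l => _ * (_ * psi j' l' _ * phi j l _))).
  (* Both conditions say that [w] and [u] become the same word when the packet is taken out of
     each. *)
  move=> l l'.
  have := insert_packetE (remove_packet w j l) u j' l' i.
  rewrite size_remove_neq 1?eq_sym// => ->.
  have := insert_packetE (remove_packet u j' l') w j l i.
  rewrite size_remove_neq// => ->.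
  rewrite (eq_sym (remove_packet u _ _)).
  by case: (l < _)%N; case: (onth (w j) l == _); case: (l' < _)%N;
    case: (onth (u j') l' == _).
move=> l l' /andP[lw /eqP wl] /andP[l'w /eqP uE].
set v := remove_packet w j l in uE *.
have wE : w = insert_packet v j l i by rewrite remove_packetK.
have ww : word_weight w * capacity N j = word_weight u * capacity N j'.
  by rewrite uE {1}wE !word_weight_insert.
have szu : size (u j) = size (v j) by rewrite uE size_insert (negPf jj').
have szw : size (w j) = (size (v j)).+1 by rewrite {1}wE size_insert eqxx.
have szu' : size (u j') = (size (w j')).+1.
  by rewrite uE {1}wE !size_insert eqxx eq_sym (negPf jj').
by rewrite szu szw szu' !mulrA ww mulrAC.
Qed.

(** The balance is against the rates of the reversed network, not of the chain itself: [phi] and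
    [psi] are exchanged and the hops run backwards. *)
Lemma detailed_balance (h : I -> nat -> J) (phi psi : J -> nat -> nat -> R) w u :
  (forall i k, (k < size (next_queues N i))%N -> h i k != h i k.+1) ->
  word_weight w * word_rate N G h phi psi w u =
  word_weight u *
    word_rate N G (fun i k => h i (size (next_queues N i) - k)%N) psi phi u w.
Proof.
move=> hh; rewrite /word_rate !mulrDr [RHS]addrC [X in _ = _ + X]addrC addrA.
congr (_ + _ + _); rewrite !mulr_sumr; apply: eq_bigr => i _.
- by rewrite subnn insert_balance.
(* The move from hop k to k + 1 is, on the reversed route with n = [size (next_queues N i)], the
   move from n - k - 1 to n - k read backwards. *)
- rewrite !mulr_sumr [RHS](reindex_inj rev_ord_inj); apply: eq_bigr => k _ /=.
  by rewrite transfer_balance ?hh// subKn// subnSK// subKn// ltnW.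
- by rewrite subn0 insert_balance.
Qed.

End Balance.

(** * The queueing chain *)

(** Concavity at the midpoint of n and n + 2 makes the increments non-increasing, so the injection
    intensities are bounded by the one at 0. *)
Lemma concave_increment (R : realType) (g : R -> \bar R) (n : nat) :
  strictly_concave_on_Rplus g -> (forall k : nat, g k%:R \is a fin_num) ->
  fine (g n.+1%:R) - fine (g n%:R) <= fine (g 1) - fine (g 0).
Proof.
move=> [_ gc] gfin; elim: n => // n; apply: le_trans.
have half : 0 < 2^-1 :> R by rewrite invr_gt0.
have half1 : 2^-1 < 1 :> R by rewrite invf_lt1// ltr1n.
have := gc n%:R n.+2%:R 2^-1 (ler0n _ _) (ler0n _ _) _ half half1.
have -> : 2^-1 * n%:R + (1 - 2^-1) * n.+2%:R = n.+1%:R :> R.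
  by rewrite -addn2 -addn1 !natrD; field.
have lt_fin k : (-oo < g k%:R)%E by rewrite ltNye_eq gfin.
rewrite eqr_nat ltn_eqF// => /(_ isT (lt_fin _) (lt_fin _)).
rewrite -(fineK (gfin n)) -(fineK (gfin n.+1)) -(fineK (gfin n.+2)).
by rewrite -!EFinM -EFinD lte_fin /=; lra.
Qed.

Lemma sumr_gt0 (R : numDomainType) (A : finType) (P : pred A) (F : A -> R) (a : A) :
  (forall b, P b -> 0 <= F b) -> P a -> 0 < F a -> 0 < \sum_(b | P b) F b.
Proof.
move=> F0 Pa Fa; rewrite (bigD1 a)//=; apply: ltr_wpDr => //.
by apply: sumr_ge0 => b /andP[/F0].
Qed.

Lemma sumr1_exists_gt0 (R : numDomainType) (n : nat) (F : nat -> R) :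
  (forall l, (l < n)%N -> 0 <= F l) -> \sum_(l < n) F l = 1 ->
  exists2 l, (l < n)%N & 0 < F l.
Proof.
move=> F0 F1; have [[l Fl]|none] := pselect (exists l : 'I_n, 0 < F l).
  by exists l.
suff : \sum_(l < n) F l = 0 by rewrite F1 => /eqP; rewrite oner_eq0.
apply: big1 => l _; apply/eqP; rewrite eq_sym; apply: contra_notT none => Fl.
by exists l; rewrite lt_neqAle Fl F0.
Qed.

(** * Events of positive rate *)

Section Positivity.
Context {R : realType} {J I : finType} (N : network R J I) (G : I -> R -> \bar R).
Variables (h : I -> nat -> J) (phi psi : J -> nat -> nat -> R).
Hypothesis phi_ge0 : forall j l n, (l < n)%N -> 0 <= phi j l n.
Hypothesis psi_ge0 : forall j l n, (l < n)%N -> 0 <= psi j l n.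
Implicit Types (w u : @words J I).

Let capacity_ge0 j : 0 <= capacity N j. Proof. exact: ltW (capacity_gt0 N j). Qed.

Let injection_ge0 w u : 0 <=
  \sum_i \sum_(l < (size (w (h i 0))).+1 | u == insert_packet w (h i 0) l i)
      injection_intensity G i (window w i) * psi (h i 0) l (size (w (h i 0))).+1.
Proof.
by do 2!apply: sumr_ge0 => ? _; rewrite mulr_ge0 ?psi_ge0//; exact: expR_ge0.
Qed.

Lemma word_rate_acknowledgement_gt0 w i l (j := h i (size (next_queues N i))) :
  onth (w j) l = Some i -> 0 < phi j l (size (w j)) ->
  0 < word_rate N G h phi psi w (remove_packet w j l).
Proof.
move=> wl phi0; have lw : (l < size (w j))%N by rewrite -onthTE wl.
apply: ltr_wpDl.
  apply: addr_ge0 => //; do 4!apply: sumr_ge0 => ? _.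
  by rewrite !mulr_ge0 ?phi_ge0 ?psi_ge0.
apply: (@sumr_gt0 _ _ _ _ i) => // [i' _|].
  by apply: sumr_ge0 => ? _; rewrite mulr_ge0 ?phi_ge0.
apply: (@sumr_gt0 _ _ _ _ (Ordinal lw)) => /= [l' _||].
- by rewrite mulr_ge0 ?phi_ge0.
- by rewrite -/j wl !eqxx.
- by rewrite mulr_gt0// capacity_gt0.
Qed.

Lemma word_rate_transfer_gt0 w i k l l' (j := h i k) (j' := h i k.+1) :
  (k < size (next_queues N i))%N ->
  onth (w j) l = Some i -> 0 < phi j l (size (w j)) ->
  (l' < (size (w j')).+1)%N -> 0 < psi j' l' (size (w j')).+1 ->
  0 < word_rate N G h phi psi w (insert_packet (remove_packet w j l) j' l' i).
Proof.
move=> kn wl phi0 l'w psi0; have lw : (l < size (w j))%N by rewrite -onthTE wl.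
apply: ltr_wpDr.
  by do 2!apply: sumr_ge0 => ? _; rewrite mulr_ge0 ?phi_ge0.
apply: ltr_wpDl => //.
apply: (@sumr_gt0 _ _ _ _ i) => // [i' _|].
  by do 3!apply: sumr_ge0 => ? _; rewrite !mulr_ge0 ?phi_ge0 ?psi_ge0.
apply: (@sumr_gt0 _ _ _ _ (Ordinal kn)) => // [k' _|].
  by do 2!apply: sumr_ge0 => ? _; rewrite !mulr_ge0 ?phi_ge0 ?psi_ge0.
apply: (@sumr_gt0 _ _ _ _ (Ordinal lw)) => /= [l'' _||].
- by apply: sumr_ge0 => ? _; rewrite !mulr_ge0 ?phi_ge0 ?psi_ge0.
- by rewrite -/j wl.
apply: (@sumr_gt0 _ _ _ _ (Ordinal l'w)) => //= [l'' _|].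
- by rewrite !mulr_ge0 ?phi_ge0 ?psi_ge0.
- by rewrite !mulr_gt0// capacity_gt0.
Qed.

End Positivity.

Section Chain.
Context {R : realType} {J I : finType} (N : network R J I) (G : I -> R -> \bar R).
Implicit Types (w u v : @words J I) (s : state N).

Lemma big_incidence (T : Type) (idx : T) (op : Monoid.com_law idx)
    (P : pred (J * I)) (F : J -> I -> T) :
  \big[op/idx]_(k : incidence N | P (val k)) F (val k).1 (val k).2 =
  \big[op/idx]_j \big[op/idx]_(i | (j \in route N i) && P (j, i)) F j i.
Proof.
rewrite pair_big_dep/=.
rewrite -(big_sub_cond [pred ji | ji.1 \in route N ji.2] P (fun ji => F ji.1 ji.2)).
by apply: eq_bigl => -[j i].
Qed.

Lemma count_mem_routed w j i : routed N w -> j \notin route N i -> count_mem i (w j) = 0%N.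
Proof.
move=> /forallP/(_ j)/allP wr ji; apply/count_memPn; by apply: contra ji; exact: wr.
Qed.

Lemma window_total_counts_of s i : window_total (counts_of s) i = window (val s) i.
Proof.
rewrite /window_total.
under eq_bigr do rewrite ffunE.
rewrite (big_incidence _ (fun ji => ji.2 == i) (fun j i => count_mem i (val s j))).
apply: eq_bigr => j _.
rewrite big_mkcondl /= big_pred1_eq; case: ifPn => // ji.
by rewrite count_mem_routed// routed_state.
Qed.

Lemma rateE s s' :
  rate G s s' = word_rate N G (hop N) (gamma N) (delta N) (val s) (val s').
Proof.
congr (_ + _ + _); apply: eq_bigr => i _.
by rewrite window_total_counts_of.
Qed.

Lemma hop_enum i : [seq hop N i (k : 'I__) | k <- enum 'I_(size (next_queues N i)).+1]
  = route N i.
Proof. by rewrite (map_comp (hop N i) val) val_enum_ord map_nth_iota0// take_oversize. Qed.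

Lemma hop_neq i k : (k < size (next_queues N i))%N -> hop N i k != hop N i k.+1.
Proof.
move=> kn; rewrite nth_uniq ?route_uniq//; last by rewrite ltnS ltnW.
by rewrite ltn_eqF.
Qed.

Lemma rev_hop_enum i :
  perm_eq [seq hop N i (size (next_queues N i) - (k : 'I__))%N
             | k <- enum 'I_(size (next_queues N i)).+1] (route N i).
Proof.
rewrite -[X in perm_eq _ X]hop_enum.
rewrite (map_comp (fun k : 'I_(size (next_queues N i)).+1 => hop N i k) (@rev_ord _) (enum _)).
apply: perm_map; apply: uniq_perm; rewrite ?enum_uniq//.
  by rewrite map_inj_uniq ?enum_uniq//; exact: rev_ord_inj.
move=> k; rewrite mem_enum; apply/mapP; exists (rev_ord k); rewrite ?mem_enum//.
by rewrite rev_ordK.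
Qed.

Lemma rate_mass s : mass (fun s' : state N => rate G s s') (total_rate N G (val s)).
Proof.
have -> : (fun s' => rate G s s') =
    fun s' : state N => word_rate N G (hop N) (gamma N) (delta N) (val s) (val s').
  by apply/funext => s'; exact: rateE.
apply: word_rate_mass.
- exact: gamma_ge0.
- exact: gamma_sum1.
- exact: delta_ge0.
- exact: delta_sum1.
- by move=> i; rewrite hop_enum.
Qed.

(** Every event changes the length of some queue: the first queue of the route grows, the next one
    grows, or the last one shrinks. *)
Lemma rate_diag s : rate G s s = 0.
Proof.
have sz_neq w u j : size (w j) != size (u j) -> (w == u) = false.
  by apply: contraNF => /eqP->.
rewrite rateE /word_rate; set w := val s; rewrite !big1 ?addr0// => i _.
- rewrite big1// => l /andP[/eqP wl]; rewrite (@sz_neq _ _ (hop N i (size (next_queues N i))))//.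
  rewrite ffunE eqxx size_cat size_drop size_takel.
    have : (l < size (w (hop N i (size (next_queues N i)))))%N by [].
    by lia.
  by rewrite ltnW.
- rewrite big1// => k _; rewrite big1// => l _; rewrite big1// => l' /eqP.
  move/(congr1 (fun w' : words => size (w' (hop N i k.+1)))).
  rewrite size_insert eqxx size_remove_neq; first by lia.
  by rewrite eq_sym hop_neq.
- rewrite big1// => l; rewrite (@sz_neq _ _ (hop N i 0))//.
  by rewrite size_insert eqxx; lia.
Qed.

Lemma exit_rate_rate s : exit_rate (rate G) s = total_rate N G (val s).
Proof. by rewrite (exit_rateE rate_diag) (rate_mass s).2. Qed.

(** The inflow into a state is its weight times the total rate of the reversed network out of it,
    which is [total_rate] again; equality even holds. *)
Lemma word_weight_excessive : excessive (@rate R J I N G) (fun s => word_weight N G (val s)).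
Proof.
split=> [s|s']; first exact: ltW (word_weight_gt0 _ _ _).
rewrite exit_rate_rate.
under eq_esum => s _ do rewrite rateE (detailed_balance _ _ _ _ _ hop_neq).
have := word_rate_mass G (h := fun i k => hop N i (size (next_queues N i) - k)%N)
  (@delta_ge0 _ _ _ N) (@delta_sum1 _ _ _ N) (@gamma_ge0 _ _ _ N) (@gamma_sum1 _ _ _ N)
  rev_hop_enum s'.
by move=> /(massZ (ltW (word_weight_gt0 N G (val s'))))[_ ->].
Qed.

Lemma total_rate_le w :
  (forall i, strictly_concave_on_Rplus (G i)) ->
  (forall i (n : nat), G i n%:R \is a fin_num) ->
  total_rate N G w <= \sum_i injection_intensity G i 0 + \sum_j capacity N j.
Proof.
move=> Gc Gf; apply: lerD; apply: ler_sum => i _; last first.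
  by case: ifP => // _; rewrite ltW// capacity_gt0.
by rewrite ler_expR; exact: concave_increment.
Qed.

(** The number of services that the packets still need in all, the one at the present queue
    included; it is the height for reaching the empty state. *)
Definition remaining_hops w : nat :=
  (\sum_j \sum_(i <- w j) (size (route N i) - index j (route N i)))%N.

Definition empty_words : @words J I := [ffun _ => [::]].

Lemma routed_empty : routed N empty_words.
Proof. by apply/forallP => j; rewrite ffunE. Qed.

Definition empty_state : state N := Sub empty_words routed_empty.

Lemma remaining_hops_decr s : s != empty_state ->
  exists2 s', 0 < rate G s s' & (remaining_hops (val s') < remaining_hops (val s))%N.
Proof.
set w := val s => s0.
have [j wj] : exists j, w j != [::].
  apply/existsP; apply: contraNT s0; rewrite negb_exists => /forallP we.
  rewrite -val_eqE /=; apply/eqP/ffunP => j; rewrite ffunE; apply/eqP.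
  by have := we j; rewrite negbK.
have wj0 : (0 < size (w j))%N by rewrite lt0n size_eq0.
(* Some proportions may vanish, but they sum to 1, so a position with positive rate exists; [l']
   below is found in the same way. *)
have [l lw gl] : exists2 l, (l < size (w j))%N & 0 < gamma N j l (size (w j)).
  by apply: sumr1_exists_gt0 (gamma_sum1 N j wj0) => l; exact: gamma_ge0.
have := lw; rewrite -onthTE; case wl : onth => [i|]// _.
have ji : j \in route N i.
  by apply: (allP (forallP (routed_state s) j)); apply/onthP; exists l.
pose v := remove_packet w j l.
have rv : routed N v by exact: routed_remove (routed_state s).
have hops : (remaining_hops w = (size (route N i) - index j (route N i)) + remaining_hops v)%N.
  by rewrite -(remove_packetK wl) /remaining_hops
    (big_insert_packet _ (fun j i => (size (route N i) - index j (route N i))%N)).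
have hk : hop N i (index j (route N i)) = j by rewrite /hop nth_index.
have ltk : (index j (route N i) < (size (next_queues N i)).+1)%N.
  by rewrite [X in (_ < X)%N](_ : _ = size (route N i))// index_mem.
have [last|notlast] := eqVneq (index j (route N i)) (size (next_queues N i)).
  exists (Sub v rv : state N).
    rewrite rateE SubK /v -hk last.
    apply: word_rate_acknowledgement_gt0; rewrite -?last ?hk//.
    - exact: gamma_ge0.
    - exact: delta_ge0.
  by rewrite SubK hops -[X in (X < _)%N]add0n ltn_add2r subn_gt0 index_mem.
have kn : (index j (route N i) < size (next_queues N i))%N.
  by rewrite ltn_neqAle notlast -ltnS.
set k := index j (route N i) in hk ltk kn hops notlast *.
set j' := hop N i k.+1.
have j'i : j' \in route N i by rewrite /j' /hop mem_nth.
have [l' l'w dl'] : exists2 l', (l' < (size (w j')).+1)%N & 0 < delta N j' l' (size (w j')).+1.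
  by apply: sumr1_exists_gt0 (delta_sum1 N j' _) => // l'; exact: delta_ge0.
have ri : routed N (insert_packet v j' l' i) by exact: routed_insert.
exists (Sub _ ri : state N).
  rewrite rateE SubK /v -hk; apply: word_rate_transfer_gt0; rewrite ?hk//.
  - exact: gamma_ge0.
  - exact: delta_ge0.
rewrite SubK hops /remaining_hops
  (big_insert_packet _ (fun j i => (size (route N i) - index j (route N i))%N)).
rewrite ltn_add2r /j' /hop index_uniq ?route_uniq//.
by rewrite ltn_sub2l// ltnW.
Qed.

End Chain.

(** * Number of orderings of given counts *)

(** Induction on the length through the first letter [x]: the rest is a permutation of [rem x s],
    and the multiplicities of the letters sum to the length. *)
Lemma size_permutations_mult (I : finType) (s : seq I) :
  (size (permutations s) * \prod_i (count_mem i s)`! = (size s)`!)%N.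
Proof.
have [n] := ubnP (size s); elim: n s => // n IH s; rewrite ltnS => sn.
have [/size0nil->|s0] := posnP (size s); first by rewrite /= big1.
rewrite (perm_size (permutationsE s0)) size_allpairs_dep sumnE big_map big_distrl/=.
transitivity (\sum_(x <- undup s) (count_mem x s * (size s).-1`!))%N.
  apply: eq_big_seq => x; rewrite mem_undup => xs.
  have sz : size (rem x s) = (size s).-1 by rewrite size_rem.
  rewrite -sz -IH; last by rewrite sz; lia.
  rewrite mulnCA; congr (_ * _)%N.
  rewrite (bigD1 x)//= [in RHS](bigD1 x)//= mulnA count_mem_rem eqxx.
  congr (_ * _)%N; last first.
    by apply: eq_bigr => i /negPf ix; rewrite count_mem_rem eq_sym ix subn0.
  have : (0 < count_mem x s)%N by rewrite -has_count has_pred1.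
  by case: (count_mem x s) => // m _; rewrite subn1/= factS.
rewrite -big_distrl/=.
have -> : (\sum_(x <- undup s) count_mem x s = size s)%N.
  rewrite -[in RHS](perm_size (perm_count_undup s)) size_flatten sumnE !big_map.
  by apply: eq_bigr => x _; rewrite size_nseq.
by rewrite -[in LHS](prednK s0) -factS prednK.
Qed.

Section Counting.
Context {R : realType} {J I : finType} (N : network R J I).
Implicit Types (m : counts N) (s : state N) (j : J) (i : I).

Definition count_at m j i : nat := (\sum_(k : incidence N | val k == (j, i)) m k)%N.

(** One fixed ordering of the packets counted by [m]; the states with counts [m] are its
    permutations, queue by queue. *)
Definition reference_word m j : seq I := flatten [seq nseq (count_at m j i) i | i <- enum I].

Lemma count_reference_word m j i : count_mem i (reference_word m j) = count_at m j i.
Proof.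
rewrite count_flatten sumnE 2!big_map big_enum/= (bigD1 i)//= big1 ?addn0.
  by rewrite count_nseq/= eqxx mul1n.
by move=> i' /negPf ni; rewrite count_nseq/= ni.
Qed.

Lemma perm_eq_count_mem (s t : seq I) :
  perm_eq s t = [forall i, count_mem i s == count_mem i t].
Proof.
apply/idP/forallP => [/permP st i|st]; first by apply/eqP.
by apply/allP => i _; exact: st.
Qed.

Lemma count_at_incidence m (k : incidence N) : count_at m (val k).1 (val k).2 = m k.
Proof.
by rewrite /count_at (big_pred1 k)// => k'; rewrite /= -surjective_pairing val_eqE.
Qed.

Lemma count_at_out m j i : j \notin route N i -> count_at m j i = 0%N.
Proof.
move=> ji; rewrite /count_at big1// => k /eqP kji.
by have := valP k; rewrite kji /= (negPf ji).
Qed.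

Lemma counts_ofP s m :
  (counts_of s == m) = [forall j, perm_eq (val s j) (reference_word m j)].
Proof.
apply/eqP/forallP => [<- j|sm].
  rewrite perm_eq_count_mem; apply/forallP => i; rewrite count_reference_word.
  have [ji|ji] := boolP (j \in route N i).
    have := count_at_incidence (counts_of s) (Sub (j, i) ji : incidence N).
    by rewrite SubK /= => ->; rewrite ffunE SubK.
  rewrite count_at_out//; apply/eqP/count_memPn; apply: contra ji.
  by have /forallP/(_ j)/allP := valP s; apply.
apply/ffunP => k; rewrite ffunE.
have := sm (val k).1; rewrite perm_eq_count_mem => /forallP/(_ (val k).2)/eqP ->.
by rewrite count_reference_word count_at_incidence.
Qed.

Lemma queue_total_count m j : queue_total m j = (\sum_i count_at m j i)%N.
Proof.
rewrite /queue_total /count_at (exchange_big_dep (fun k : incidence N => (val k).1 == j))/=.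
  apply: eq_bigr => k /eqP kj.
  rewrite (big_pred1 (val k).2)// => i /=.
  by rewrite -kj [X in X == _]surjective_pairing xpair_eqE eqxx/= eq_sym.
by move=> i k _ /eqP ->.
Qed.

Lemma size_reference_word m j : size (reference_word m j) = queue_total m j.
Proof.
rewrite size_flatten sumnE 2!big_map big_enum queue_total_count.
by apply: eq_bigr => i _; rewrite size_nseq.
Qed.

Lemma fact_count_at m j :
  (\prod_i (count_at m j i)`! = \prod_(k : incidence N | (val k).1 == j) (m k)`!)%N.
Proof.
transitivity (\prod_i \prod_(k : incidence N | val k == (j, i)) (m k)`!)%N.
  apply: eq_bigr => i _; have [ji|ji] := boolP (j \in route N i).
    have -> : count_at m j i = m (Sub (j, i) ji) by rewrite -count_at_incidence SubK.
    by rewrite (big_pred1 (Sub (j, i) ji : incidence N))// => k; rewrite /= -val_eqE SubK.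
  rewrite count_at_out// big1// => k /eqP kji.
  by have := valP k; rewrite kji /= (negPf ji).
rewrite (exchange_big_dep (fun k : incidence N => (val k).1 == j))/=.
  apply: eq_bigr => k /eqP kj.
  rewrite (big_pred1 (val k).2)// => i /=.
  by rewrite -kj [X in X == _]surjective_pairing xpair_eqE eqxx/= eq_sym.
by move=> i k _ /eqP ->.
Qed.

Definition orderings m j : nat := size (permutations (reference_word m j)).

Lemma orderingsE m j :
  (orderings m j * \prod_(k : incidence N | (val k).1 == j) (m k)`! = (queue_total m j)`!)%N.
Proof.
rewrite -fact_count_at -size_reference_word -size_permutations_mult.
by congr (_ * _)%N; apply: eq_bigr => i _; rewrite count_reference_word.
Qed.

(** The orderings are chosen independently in the queues, so the fibre over [m] is a finite
    product. *)
Lemma states_with_counts m : exists r : seq (state N),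
  [/\ uniq r, size r = (\prod_j orderings m j)%N &
      [set s | counts_of s == m] = [set` r]].
Proof.
(* [L] contains every word that can occur in a queue, so that the product becomes a family of
   functions into a finite type. *)
pose L := undup (flatten [seq permutations (reference_word m j) | j <- enum J]).
pose T : finType := seq_sub L.
pose v (x : T) : seq I := ssval x.
have v_inj : injective v by exact: val_inj.
pose F j := [pred x : T | v x \in permutations (reference_word m j)].
pose wr : seq (@words J I) :=
  [seq [ffun j => v (f j)] | f : {ffun J -> T} <- enum (family F)].
have uwr : uniq wr.
  rewrite map_inj_uniq ?enum_uniq// => f g /ffunP fg; apply/ffunP => j.
  by have := fg j; rewrite !ffunE => /v_inj.
have mem_wr w : (w \in wr) = [forall j, perm_eq (w j) (reference_word m j)].
  apply/mapP/forallP => [[f + ->] j|wm].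
    by rewrite mem_enum => /familyP/(_ j); rewrite inE mem_permutations ffunE.
  have wL j : w j \in L.
    rewrite mem_undup; apply/flatten_mapP; exists j; first by rewrite mem_enum.
    by rewrite mem_permutations.
  exists [ffun j => SeqSub (wL j)]; last by apply/ffunP => j; rewrite !ffunE.
  by rewrite mem_enum; apply/familyP => j; rewrite ffunE inE mem_permutations; exact: wm.
exists (pmap insub wr); split.
- exact: pmap_sub_uniq.
(* No element of [wr] is lost by [insub]: [count_at] is 0 off the routes, so all these words are
   routed. *)
- rewrite size_pmap_sub (_ : count _ _ = size wr); last first.
    apply/eqP; rewrite -all_count; apply/allP => w; rewrite mem_wr => /forallP wm.
    apply/forallP => j; apply/allP => i; rewrite (perm_mem (wm j)).
    rewrite -has_pred1 has_count count_reference_word.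
    by apply: contraTT => /(count_at_out m) ->.
  rewrite size_map -cardE card_family foldrE big_map big_enum.
  apply: eq_bigr => j _; rewrite /orderings.
  rewrite -(size_image v); apply/perm_size/uniq_perm.
  - by rewrite map_inj_uniq ?enum_uniq.
  - exact: permutations_uniq.
  move=> x; apply/mapP/idP => [[y + ->]|xp]; first by rewrite mem_enum.
  have xL : x \in L.
    by rewrite mem_undup; apply/flatten_mapP; exists j; rewrite ?mem_enum.
  by exists (SeqSub xL); rewrite ?mem_enum.
- by apply/seteqP; split => s /=; rewrite mem_pmap_sub mem_wr -counts_ofP.
Qed.

End Counting.

(** * The law of the counts *)

Section Law.
Context {R : realType}.

Lemma lawZ (S : choiceType) (T : eqType) (c : R) (p : S -> R) (f : S -> T) (x : T) :
  0 <= c -> (forall s, 0 <= p s) ->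
  law (fun s => c * p s) f x = (c%:E * law p f x)%E.
Proof.
move=> c0 p0; rewrite /law esum_mkcond [in RHS]esum_mkcond -esumZ//; last first.
  by move=> s; case: ifP => // _; rewrite lee_fin.
by apply: eq_esum => s _; case: ifP => // _; rewrite mule0.
Qed.

Lemma esum_law (S T : choiceType) (p : S -> R) (f : S -> T) : (forall s, 0 <= p s) ->
  \esum_(x in [set: T]) law p f x = \esum_(s in [set: S]) (p s)%:E.
Proof.
move=> p0; rewrite /law; under eq_esum do rewrite esum_mkcond.
rewrite esum_exchange; last by move=> x s; case: ifP => // _; rewrite lee_fin.
apply: eq_esum => s _; rewrite (@esum_single _ _ (f s)) ?mem_set//= ?lee_fin//.
by move=> x /negPf fx; rewrite memNset//= eq_sym fx.
Qed.

End Law.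

(** [word_weight] takes the constant value [c] on the fibre over [m], and the number of states there
    is the product of the multinomial coefficients. *)
Lemma word_weight_law (R : realType) (J I : finType) (N : network R J I)
    (G : I -> R -> \bar R) (m : counts N) :
  law (fun s : state N => word_weight N G (val s)) (@counts_of R J I N) m = (weight G m)%:E.
Proof.
have [r [ur szr rE]] := states_with_counts m.
pose c := \prod_j (1 / capacity N j ^+ queue_total m j)
  * \prod_i expR (fine (G i (window_total m i)%:R)).
rewrite /law (eq_esum (b := fun=> c%:E)); last first.
  move=> s /= /eqP sm; congr EFin; rewrite /word_weight /c -sm; congr (_ * _).
    apply: eq_bigr => j _; rewrite big_const_seq count_predT iter_mulr mulr1.
    have /eqP := sm; rewrite counts_ofP => /forallP/(_ j)/perm_size sj.
    by rewrite div1r exprVn sm -size_reference_word -sj.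
  by apply: eq_bigr => i _; rewrite window_total_counts_of.
have c0 : 0 <= c.
  apply: mulr_ge0; apply: prodr_ge0 => ? _; last exact: expR_ge0.
  by rewrite div1r invr_ge0 exprn_ge0// ltW// capacity_gt0.
rewrite rE esum_fset; [|exact: finite_seq|by move=> *; rewrite lee_fin].
rewrite -fsbig_seq// sumEFin big_const_seq count_predT iter_addr_0 szr; congr EFin.
rewrite -mulr_natl natr_prod /c mulrA -big_split/=; congr (_ * _).
apply: eq_bigr => j _; congr (_ * _); rewrite -orderingsE natrM mulfK//.
by rewrite pnatr_eq0 -lt0n prodn_gt0// => k; exact: fact_gt0.
Qed.

Theorem theorem5p1 (R : realType) (J I : finType) (N : network R J I)
    (G : I -> R -> \bar R)
    (G_concave : forall i : I, strictly_concave_on_Rplus (G i))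
    (G_fin : forall (i : I) (n : nat), G i n%:R \is a fin_num)
    (P : R -> state N -> state N -> R)
    (P_chain : is_transition_function (rate G) P)
    (p : state N -> R) (p_stat : is_stationary P p) :
  (normalizer N G < +oo)%E /\
  forall m : counts N,
    law p (@counts_of R J I N) m = ((normalizer N G)^-1 * (weight G m)%:E)%E.
Proof.
pose pi (s : state N) := word_weight N G (val s).
have bound s : (\esum_(s' in [set: state N]) (rate G s s')%:E <=
    (\sum_i injection_intensity G i 0 + \sum_j capacity N j)%:E)%E.
  by rewrite (rate_mass G s).2 lee_fin total_rate_le.
have [pe0 piE] := excessive_stationary_proportional (fun s => (rate_mass G s).1)
  (@rate_diag _ _ _ N G) bound (@remaining_hops_decr _ _ _ N G) P_chain p_stat
  (word_weight_excessive N G).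
set c := _ / _ in piE.
have pi_gt0 : 0 < pi (empty_state N) by exact: word_weight_gt0.
have c0 : 0 < c by rewrite divr_gt0.
have [[p0 p1] _] := p_stat.
have weightE m : (weight G m)%:E = (c%:E * law p (@counts_of R J I N) m)%E.
  rewrite -word_weight_law -lawZ ?ltW//; apply: eq_esum => s _; congr EFin; exact: piE.
(* Summed over all counts, the law of [p] has total 1, which leaves the constant [c]. *)
have normE : normalizer N G = c%:E.
  rewrite /normalizer; under eq_esum do rewrite weightE.
  rewrite esumZ ?ltW ?esum_law ?p1 ?mule1// => m.
  by apply: esum_ge0 => s _; rewrite lee_fin.
rewrite normE ltry; split=> // m.
by rewrite weightE muleA inver gt_eqF// -EFinM mulVf ?mul1e// gt_eqF.
Qed.
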